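(* For $i=1,2$, let $(\mathfrak n_i,J_i,\langle\cdot,\cdot\rangle_i)$ be an irreducible SKT Lie algebra with $\mathfrak n_i$ $2$-step nilpotent of dimension $n_i$, with center $\mathfrak z_i$, and suppose $\dim\mathfrak z_i>\dim[\mathfrak n_i,\mathfrak n_i]$. Let $X_{n_1}\in\mathfrak z_1\cap[\mathfrak n_1,\mathfrak n_1]^\perp$ and $Y_{n_2}\in\mathfrak z_2\cap[\mathfrak n_2,\mathfrak n_2]^\perp$ be unit vectors. Let $\mathfrak g=\mathfrak n_1\oplus\mathfrak n_2\oplus\mathrm{span}\{Z,W\}$ as a vector space, of dimension $n_1+n_2+2$ (with $Z,W$ linearly independent), equipped with (1) the Lie bracket determined by $[\cdot,\cdot]|_{\mathfrak n_1\times\mathfrak n_1}=[\cdot,\cdot]_{\mathfrak n_1}$, $[\cdot,\cdot]|_{\mathfrak n_2\times\mathfrak n_2}=[\cdot,\cdot]_{\mathfrak n_2}$, $[Z,W]=X_{n_1}+Y_{n_2}$, with all brackets between different summands among $\mathfrak n_1$, $\mathfrak n_2$, $\mathrm{span}\{Z,W\}$ equal to zero; (2) the endomorphism $J$ with $J|_{\mathfrak n_1}=J_1$, $J|_{\mathfrak n_2}=J_2$, $JZ=W$, $JW=-Z$; (3) the inner product $\langle\cdot,\cdot\rangle$ extending $\langle\cdot,\cdot\rangle_1$ and $\langle\cdot,\cdot\rangle_2$ for which $\mathfrak n_1$, $\mathfrak n_2$, $\mathrm{span}\{Z,W\}$ are mutually orthogonal and $\{Z,W\}$ is orthonormal. Then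 $(\mathfrak g,J,\langle\cdot,\cdot\rangle)$ is an SKT Lie algebra, and it is irreducible.
   Context: All Lie algebras are finite-dimensional and real. A Hermitian Lie algebra is a triple $(\mathfrak g,J,\langle\cdot,\cdot\rangle)$ where $\mathfrak g$ is a real Lie algebra, $J:\mathfrak g\to\mathfrak g$ is linear with $J^2=-\mathrm{Id}$ and satisfies $[JX,JY]=[X,Y]+J[JX,Y]+J[X,JY]$ for all $X,Y$, and $\langle\cdot,\cdot\rangle$ is an inner product with $\langle J\cdot,J\cdot\rangle=\langle\cdot,\cdot\rangle$. Its Bismut torsion $3$-form is $$c(U,Y,Z)=-\langle[JU,JY],Z\rangle-\langle[JY,JZ],U\rangle-\langle[JZ,JU],Y\rangle,$$ with exterior derivative $$dc(W,U,Y,Z)=-c([W,U],Y,Z)+c([W,Y],U,Z)-c([W,Z],U,Y)-c([U,Y],W,Z)+c([U,Z],W,Y)-c([Y,Z],W,U).$$ $(\mathfrak g,J,\langle\cdot,\cdot\rangle)$ is called SKT (an SKT Lie algebra) if $dc=0$. A Lie algebra $\mathfrak n$ is $2$-step nilpotent if $[\mathfrak n,[\mathfrak n,\mathfrak n]]=0$ and $[\mathfrak n,\mathfrak n]\ne0$. An SKT Lie algebra is called irreducible if it cannot be decomposed as an orthogonal direct sum of two nonzero $J$-invariant ideals. Orthogonal complements in $\mathfrak n_i$ are taken with respect to $\langle\cdot,\cdot\rangle_i$. *)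

(* Defs.v *)
From HB Require Import structures.
From mathcomp Require Import all_boot all_order all_algebra.
From mathcomp Require Import reals.

Set Implicit Arguments.
Unset Strict Implicit.
Unset Printing Implicit Defensive.

Import Order.TTheory GRing.Theory Num.Theory.
Local Open Scope ring_scope.

Section LieAlgebra.
Variables (R : realType) (V : vectType R).
Implicit Types (br : V -> V -> V) (U W : {vspace V}).

Record is_lie_bracket br : Prop := IsLieBracket {
  lie_linear_l : forall y, linear (br^~ y);
  lie_linear_r : forall x, linear (br x);
  lie_alternating : forall x, br x x = 0;
  lie_jacobi : forall x y z,
    br x (br y z) + br y (br z x) + br z (br x y) = 0
}.

(* [U, W], the span of all brackets; it suffices to bracket basis vectors,
   see lie_prodP below (the same encoding as prodv in falgebra). *)
Definition lie_prod br U W : {vspace V} :=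
  <<[seq br u w | u <- vbasis U, w <- vbasis W]>>%VS.

Definition derived_algebra br : {vspace V} := lie_prod br fullv fullv.

(* The kernel of the adjoint map x |-> (y |-> [x, y]), see mem_lie_center. *)
Definition lie_center br : {vspace V} :=
  lker (linfun (fun x => linfun (br x) : 'End(V))).

Definition two_step_nilpotent br : Prop :=
  lie_prod br fullv (derived_algebra br) = 0%VS /\ derived_algebra br <> 0%VS.

Definition lie_ideal br U : Prop :=
  forall x u, u \in U -> br x u \in U.

Lemma lie_prodP br U W (T : {vspace V}) : is_lie_bracket br ->
  (forall u w, u \in U -> w \in W -> br u w \in T) <->
  (lie_prod br U W <= T)%VS.
Proof.
move=> brL; split=> [sT | sT u w /coord_vbasis-> /coord_vbasis->].
  apply/span_subvP=> _ /allpairsP[[u w] /= [Uu Ww ->]].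
  by rewrite sT ?vbasis_mem.
have br_suml n (F : 'I_n -> V) y :
    br (\sum_i F i) y = \sum_i br (F i) y.
  have D x1 x2 : br (x1 + x2) y = br x1 y + br x2 y.
    by have := lie_linear_l brL y 1 x1 x2; rewrite /= !scale1r.
  apply: (big_morph (br^~ y)) => //.
  by apply: (@addrI _ (br 0 y)); rewrite -D !addr0.
have br_sumr n (F : 'I_n -> V) x :
    br x (\sum_i F i) = \sum_i br x (F i).
  have D y1 y2 : br x (y1 + y2) = br x y1 + br x y2.
    by have := lie_linear_r brL x 1 y1 y2; rewrite /= !scale1r.
  apply: (big_morph (br x)) => //.
  by apply: (@addrI _ (br x 0)); rewrite -D !addr0.
have brZl a x y : br (a *: x) y = a *: br x y.
  have := lie_linear_l brL y a x 0; rewrite /= !addr0 => ->.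
  suff -> : br 0 y = 0 by rewrite addr0.
  by have := br_suml 0 (fun=> 0) y; rewrite !big_ord0.
have brZr a x y : br x (a *: y) = a *: br x y.
  have := lie_linear_r brL x a y 0; rewrite /= !addr0 => ->.
  suff -> : br x 0 = 0 by rewrite addr0.
  by have := br_sumr 0 (fun=> 0) x; rewrite !big_ord0.
apply: (subvP sT); rewrite br_suml; apply: memv_suml => i _.
rewrite br_sumr; apply: memv_suml => j _.
rewrite brZl brZr !memvZ // memv_span //.
by apply/allpairsP; exists ((vbasis U)`_i, (vbasis W)`_j); rewrite !memt_nth.
Qed.

Lemma mem_lie_center br x : is_lie_bracket br ->
  x \in lie_center br <-> forall y, br x y = 0.
Proof.
move=> brL.
have ad_lin y : linear (br y) by exact: lie_linear_r.
pose ad_ y : {linear V -> V} :=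
  HB.pack (br y) (GRing.isLinear.Build R V V *:%R (br y) (ad_lin y)).
have adE y z : linfun (br y) z = br y z by exact: (lfunE (ad_ y) z).
pose Ad y : 'End(V) := linfun (br y).
have Ad_lin : linear Ad.
  move=> a u v; apply/lfunP=> z; rewrite add_lfunE scale_lfunE !adE.
  exact: (lie_linear_l brL).
pose AdL : {linear V -> 'End(V)} :=
  HB.pack Ad (GRing.isLinear.Build R V 'End(V) *:%R Ad Ad_lin).
have AdE : linfun Ad x = Ad x by exact: (lfunE AdL x).
rewrite memv_ker AdE; split=> [/eqP Ad0 y | x0].
  by rewrite -adE -/(Ad x) Ad0 lfunE.
by apply/eqP/lfunP=> y; rewrite adE x0 lfunE.
Qed.

End LieAlgebra.

Section HermitianLieAlgebra.
Variables (R : realType) (V : vectType R).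
Implicit Types (br : V -> V -> V) (J : V -> V) (ip : V -> V -> R).

Record is_complex_structure br J : Prop := IsComplexStructure {
  cs_linear : linear J;
  cs_square : forall x, J (J x) = - x;
  cs_integrable : forall x y,
    br (J x) (J y) = br x y + J (br (J x) y) + J (br x (J y))
}.

Record is_inner_product ip : Prop := IsInnerProduct {
  ip_linear_l : forall y, scalar (ip^~ y);
  ip_sym : forall x y, ip x y = ip y x;
  ip_pos : forall x, x != 0 -> 0 < ip x x
}.

Record is_hermitian_lie br J ip : Prop := IsHermitianLie {
  herm_lie : is_lie_bracket br;
  herm_complex : is_complex_structure br J;
  herm_inner : is_inner_product ip;
  herm_compat : forall x y, ip (J x) (J y) = ip x y
}.

Definition bismut_torsion br J ip (u y z : V) : R :=
  - ip (br (J u) (J y)) z - ip (br (J y) (J z)) u - ip (br (J z) (J u)) y.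

Definition d_bismut_torsion br J ip (w u y z : V) : R :=
  let c := bismut_torsion br J ip in
  - c (br w u) y z + c (br w y) u z - c (br w z) u y
  - c (br u y) w z + c (br u z) w y - c (br y z) w u.

Definition is_SKT br J ip : Prop :=
  is_hermitian_lie br J ip /\
  forall w u y z, d_bismut_torsion br J ip w u y z = 0.

Definition J_invariant J (U : {vspace V}) : Prop :=
  forall u, u \in U -> J u \in U.

Definition irreducible_SKT br J ip : Prop :=
  ~ exists U W : {vspace V},
    [/\ U <> 0%VS /\ W <> 0%VS,
        (U + W)%VS = fullv /\ directv (U + W),
        (forall u w, u \in U -> w \in W -> ip u w = 0),
        lie_ideal br U /\ lie_ideal br W
      & J_invariant J U /\ J_invariant J W].

Definition in_orthogonal ip (U : {vspace V}) (x : V) : Prop :=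
  forall u, u \in U -> ip x u = 0.

End HermitianLieAlgebra.

(* n1 (+) n2 (+) span{Z, W}: an element (x1, x2, (a, b)) stands for
   x1 + x2 + a Z + b W. *)
Section Glue.
Variables (R : realType) (V1 V2 : vectType R).

Definition glue : vectType R := (V1 * V2 * (R^o * R^o))%type.

Implicit Types p q : glue.

(* [a Z + b W, c Z + d W] = (a d - b c) [Z, W] = (a d - b c) (X + Y) *)
Definition glue_br (br1 : V1 -> V1 -> V1) (br2 : V2 -> V2 -> V2)
    (X : V1) (Y : V2) p q : glue :=
  let: (x1, x2, (a, b)) := p in
  let: (y1, y2, (c, d)) := q in
  (br1 x1 y1 + (a * d - b * c) *: X, br2 x2 y2 + (a * d - b * c) *: Y, (0, 0)).

Definition glue_J (J1 : V1 -> V1) (J2 : V2 -> V2) p : glue :=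
  let: (x1, x2, (a, b)) := p in (J1 x1, J2 x2, (- b, a)).

Definition glue_ip (ip1 : V1 -> V1 -> R) (ip2 : V2 -> V2 -> R) p q : R :=
  let: (x1, x2, (a, b)) := p in
  let: (y1, y2, (c, d)) := q in
  ip1 x1 y1 + ip2 x2 y2 + (a * c + b * d).

End Glue.

(* Main.v *)
Require Import Defs.
From HB Require Import structures.
From mathcomp Require Import all_boot all_order all_algebra.
From mathcomp Require Import reals.
From mathcomp Require Import ring lra.

(** In a 2-step nilpotent SKT Lie algebra the center is J-invariant: for central
    x, the operator A = ad (J x) commutes with J and has A^2 = 0, and then the
    equation dc(x, Jx, Jz, z) = 0 reads 2 |A z|^2 = 0.
    Hence X and Y contract the torsion forms of n_1 and n_2 to zero, and with
    omega the area form of span{Z, W} the torsion form of g is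
    c_1 + c_2 - omega /\ (X + Y)^flat, whose differential is a multiple of
    omega /\ omega = 0.

    For irreducibility, let g = U + T be an orthogonal decomposition into
    J-invariant ideals.  An irreducible n_i has no nonzero central vector
    orthogonal to n_i' + J n_i', because such a vector and its J-image would
    span a summand.  This forces each n_i to be compatible with the
    decomposition, so that n_i lies in U or in T.  Since [Z, W] = X + Y has
    nonzero components in both, n_1 and n_2 lie in the same summand, and the
    other one is zero. *)

Set Implicit Arguments.
Unset Strict Implicit.
Unset Printing Implicit Defensive.

Import Order.TTheory GRing.Theory Num.Theory.
Local Open Scope ring_scope.

(** * Consequences of linearity for functions that are not bundled as linear maps *)

Section LinearFor.
Variables (R : nzRingType) (U : lmodType R) (V : zmodType).
Variables (s : GRing.Scale.law R V) (f : U -> V).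
Hypothesis fL : linear_for s f.

Lemma linear_for_add x y : f (x + y) = f x + f y.
Proof.
pose F : {linear U -> V | s} := HB.pack f (GRing.isLinear.Build R U V s f fL).
exact: (raddfD F).
Qed.

Lemma linear_for_zero : f 0 = 0.
Proof.
pose F : {linear U -> V | s} := HB.pack f (GRing.isLinear.Build R U V s f fL).
exact: (raddf0 F).
Qed.

Lemma linear_for_opp x : f (- x) = - f x.
Proof.
pose F : {linear U -> V | s} := HB.pack f (GRing.isLinear.Build R U V s f fL).
exact: (raddfN F).
Qed.

Lemma linear_for_scale a x : f (a *: x) = s a (f x).
Proof.
pose F : {linear U -> V | s} := HB.pack f (GRing.isLinear.Build R U V s f fL).
exact: (linearZ_LR F).
Qed.

End LinearFor.

(** * Hermitian Lie algebras: central elements and flat factors *)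

Section HermitianLie.
Variables (R : realType) (V : vectType R).
Variables (br : V -> V -> V) (J : V -> V) (ip : V -> V -> R).

Section Bracket.
Hypothesis brL : is_lie_bracket br.

Lemma brDl x y z : br (x + y) z = br x z + br y z.
Proof. exact: (linear_for_add (lie_linear_l brL z)). Qed.
Lemma brDr x y z : br x (y + z) = br x y + br x z.
Proof. exact: (linear_for_add (lie_linear_r brL x)). Qed.
Lemma brZl a x z : br (a *: x) z = a *: br x z.
Proof. exact: (linear_for_scale (lie_linear_l brL z)). Qed.
Lemma brZr a x z : br x (a *: z) = a *: br x z.
Proof. exact: (linear_for_scale (lie_linear_r brL x)). Qed.
Lemma brNl x z : br (- x) z = - br x z.
Proof. exact: (linear_for_opp (lie_linear_l brL z)). Qed.
Lemma brNr x z : br x (- z) = - br x z.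
Proof. exact: (linear_for_opp (lie_linear_r brL x)). Qed.
Lemma br0l z : br 0 z = 0.
Proof. exact: (linear_for_zero (lie_linear_l brL z)). Qed.
Lemma br0r x : br x 0 = 0.
Proof. exact: (linear_for_zero (lie_linear_r brL x)). Qed.

Lemma br_anti x y : br x y = - br y x.
Proof.
apply/eqP; rewrite -addr_eq0; apply/eqP.
have := lie_alternating brL (x + y).
by rewrite brDl !brDr !(lie_alternating brL) add0r addr0.
Qed.

Lemma mem_derived x y : br x y \in derived_algebra br.
Proof.
by apply: (proj2 (lie_prodP fullv fullv _ brL) (subvv _)); rewrite memvf.
Qed.

Lemma derived_central x y z :
  two_step_nilpotent br -> br x (br y z) = 0.
Proof.
move=> [nil _]; apply/eqP; rewrite -memv0 -nil.
apply: (proj2 (lie_prodP fullv _ _ brL) (subvv _)); first exact: memvf.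
exact: mem_derived.
Qed.


End Bracket.

Section InnerProduct.
Hypothesis ipI : is_inner_product ip.

Lemma ipDl x y z : ip (x + y) z = ip x z + ip y z.
Proof. exact: (linear_for_add (ip_linear_l ipI z)). Qed.
Lemma ipZl a x z : ip (a *: x) z = a * ip x z.
Proof. exact: (linear_for_scale (ip_linear_l ipI z)). Qed.
Lemma ipNl x z : ip (- x) z = - ip x z.
Proof. exact: (linear_for_opp (ip_linear_l ipI z)). Qed.
Lemma ip0l z : ip 0 z = 0.
Proof. exact: (linear_for_zero (ip_linear_l ipI z)). Qed.
Lemma ipDr x y z : ip x (y + z) = ip x y + ip x z.
Proof. by rewrite !(ip_sym ipI x) ipDl. Qed.
Lemma ipZr a x z : ip x (a *: z) = a * ip x z.
Proof. by rewrite !(ip_sym ipI x) ipZl. Qed.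
Lemma ipNr x z : ip x (- z) = - ip x z.
Proof. by rewrite !(ip_sym ipI x) ipNl. Qed.
Lemma ip0r x : ip x 0 = 0.
Proof. by rewrite (ip_sym ipI) ip0l. Qed.

Lemma ip_eq0 x : ip x x = 0 -> x = 0.
Proof.
move=> xx0; apply/eqP; apply: contraTT isT => /(ip_pos ipI).
by rewrite xx0 ltxx.
Qed.

End InnerProduct.

Hypothesis herm : is_hermitian_lie br J ip.
Let brL := herm_lie herm.
Let ipI := herm_inner herm.

Lemma JD x y : J (x + y) = J x + J y.
Proof. exact: (linear_for_add (cs_linear (herm_complex herm))). Qed.
Lemma JZ a x : J (a *: x) = a *: J x.
Proof. exact: (linear_for_scale (cs_linear (herm_complex herm))). Qed.
Lemma J0 : J 0 = 0.
Proof. exact: (linear_for_zero (cs_linear (herm_complex herm))). Qed.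
Lemma JJ x : J (J x) = - x.
Proof. exact: (cs_square (herm_complex herm)). Qed.

(** An isometry whose square is minus the identity is skew-adjoint. *)
Lemma ip_J_r x y : ip x (J y) = - ip (J x) y.
Proof. by rewrite -(herm_compat herm) JJ (ipNr ipI). Qed.

Lemma ip_J_self x : ip x (J x) = 0.
Proof.
have := ip_J_r x x; rewrite (ip_sym ipI (J x)); move=> H; lra.
Qed.

Lemma bismutDl u v y z : bismut_torsion br J ip (u + v) y z =
  bismut_torsion br J ip u y z + bismut_torsion br J ip v y z.
Proof.
rewrite /bismut_torsion JD (brDl brL) (brDr brL) !(ipDl ipI) (ipDr ipI); ring.
Qed.

Lemma bismutZl a u y z :
  bismut_torsion br J ip (a *: u) y z = a * bismut_torsion br J ip u y z.
Proof.
rewrite /bismut_torsion JZ (brZl brL) (brZr brL) !(ipZl ipI) (ipZr ipI); ring.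
Qed.

Section CentralElement.
Variable x : V.
Hypothesis x_central : forall y, br x y = 0.

Let x_centralr y : br y x = 0.
Proof. by rewrite (br_anti brL) x_central oppr0. Qed.

Lemma br_J_central y : br (J x) (J y) = J (br (J x) y).
Proof.
by rewrite (cs_integrable (herm_complex herm)) !x_central J0 add0r addr0.
Qed.

Lemma center_J_invariant :
  (forall w u y z, d_bismut_torsion br J ip w u y z = 0) ->
  two_step_nilpotent br -> forall z, br (J x) z = 0.
Proof.
move=> dc0 nil z; apply: (ip_eq0 ipI).
(* With A the bracket by [J x], the vector J A u = A J u is again a bracket, hence central. *)
have JAC u v : br (J (br (J x) u)) v = 0.
  by rewrite -br_J_central (br_anti brL) (derived_central brL) ?oppr0.
have T0 : br (J (br (J z) z)) (J x) = 0.
  by rewrite (br_anti brL) br_J_central (derived_central brL) // J0 oppr0.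
have JACr u v : br v (J (br (J x) u)) = 0.
  by rewrite (br_anti brL) JAC oppr0.
(* Only the terms with [Jx, Jz] = J A z and [Jx, z] = A z survive, and each contributes |A z|^2; the
   term with [Jz, z] vanishes by [T0]. *)
have := dc0 x (J x) (J z) z.
rewrite /d_bismut_torsion /bismut_torsion !x_central ?JJ ?J0.
rewrite !JAC ?JACr ?T0 ?(brNl brL) ?(brNr brL) ?x_central ?x_centralr.
rewrite ?(br0l brL) ?(br0r brL) ?(ip0l ipI) ?(ip0r ipI) ?oppr0.
rewrite !br_J_central ?(ipNl ipI) ?(ipNr ipI) ?(ip0l ipI).
rewrite (herm_compat herm); lra.
Qed.

End CentralElement.

Lemma orthogonal_directv (U W : {vspace V}) :
  (forall u w, u \in U -> w \in W -> ip u w = 0) -> directv (U + W).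
Proof.
move=> UW; apply/directv_addP/eqP; rewrite -subv0; apply/subvP=> v.
rewrite memv_cap memv0 => /andP[vU vW].
by apply/eqP/(ip_eq0 ipI)/UW.
Qed.

Definition ip_perp (t : V) : {vspace V} :=
  lker (linfun ((fun x => ip x t) : V -> R^o)).

Lemma mem_ip_perp t x : (x \in ip_perp t) = (ip x t == 0).
Proof.
pose F : {linear V -> R^o} := HB.pack ((fun x => ip x t) : V -> R^o)
  (GRing.isLinear.Build R V R^o *:%R _ (ip_linear_l ipI t)).
by rewrite memv_ker (lfunE F).
Qed.

(** Two of the three brackets in the torsion contain the central vector [J x]; the third is paired
    with [x], which is orthogonal to all brackets. *)
Lemma bismut_center_eq0 x y z : (forall v, br x v = 0) ->
  (forall v, br (J x) v = 0) -> (forall u v, ip x (br u v) = 0) ->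
  bismut_torsion br J ip x y z = 0.
Proof.
move=> xC JxC xD.
rewrite /bismut_torsion JxC (br_anti brL _ (J x)) JxC (ip_sym ipI _ x) xD.
by rewrite !oppr0 !(ip0l ipI) !oppr0 !addr0.
Qed.

(** A nonzero [t] would split off the plane spanned by [t] and [J t]. This plane is central and its
    orthogonal complement contains every bracket, so both are ideals, and both are J-invariant. *)
Lemma irreducible_no_flat_factor t :
  irreducible_SKT br J ip -> two_step_nilpotent br ->
  (forall y, br t y = 0) -> (forall y, br (J t) y = 0) ->
  (forall x y, ip t (br x y) = 0) -> (forall x y, ip (J t) (br x y) = 0) ->
  t = 0.
Proof.
move=> irr nil tC JtC tD JtD; apply/eqP; case: eqVneq => // t0.
have tt0 : ip t t != 0 by rewrite gt_eqF // (ip_pos ipI).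
have JtJt : ip (J t) (J t) = ip t t by rewrite (herm_compat herm).
have tJt : ip t (J t) = 0 by exact: ip_J_self.
have Jtt : ip (J t) t = 0 by rewrite (ip_sym ipI).
pose U := (<[t]> + <[J t]>)%VS; pose W := (ip_perp t :&: ip_perp (J t))%VS.
have memW x : reflect (ip x t = 0 /\ ip x (J t) = 0) (x \in W).
  rewrite memv_cap !mem_ip_perp.
  by apply: (iffP andP) => -[/eqP-> /eqP->].
have memU u : u \in U -> exists a b, u = a *: t + b *: J t.
  move=> /memv_addP[_ /vlineP[a ->] [_ /vlineP[b ->] ->]].
  by exists a, b.
have inU a b : a *: t + b *: J t \in U by rewrite memv_add ?memvZ ?memv_line.
have perp u w : u \in U -> w \in W -> ip u w = 0.
  move=> /memU[a [b ->]] /memW[wt wJt].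
  by rewrite (ipDl ipI) !(ipZl ipI) !(ip_sym ipI _ w) wt wJt !mulr0 addr0.
have brW x y : br x y \in W.
  by apply/memW; rewrite !(ip_sym ipI (br x y)).
case: irr; exists U, W; split.
- split=> /eqP; rewrite -subv0 => /subvP sub0.
    have /sub0 : t \in U by have := inU 1 0; rewrite scale1r scale0r addr0.
    by rewrite memv0 (negPf t0).
  (* If the complement were zero, so would be the derived algebra, which it contains. *)
  case: nil => _; apply; apply/eqP; rewrite -subv0.
  by apply: (proj1 (lie_prodP fullv fullv _ brL)) => u w _ _; apply: sub0.
- split; last exact: orthogonal_directv.
  apply/eqP; rewrite eqEsubv subvf /=; apply/subvP=> x _; apply/memv_addP.
  (* Coefficients of the orthogonal projection to the plane: [J t] is orthogonal to [t] and has the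
     same length. *)
  pose a := ip x t / ip t t; pose b := ip x (J t) / ip t t.
  exists (a *: t + b *: J t); first exact: inU.
  exists (x - (a *: t + b *: J t)); last by rewrite addrC subrK.
  apply/memW; rewrite !(ipDl ipI) !(ipNl ipI) !(ipDl ipI) !(ipZl ipI).
  by rewrite JtJt tJt Jtt /a /b; split; field.
- exact: perp.
- split=> [x u /memU[a [b ->]] | x w _]; last exact: brW.
  rewrite (br_anti brL) (brDl brL) !(brZl brL) tC JtC !scaler0 addr0 oppr0.
  exact: mem0v.
- split=> [u /memU[a [b ->]] | w /memW[wt wJt]].
    by rewrite JD !JZ JJ scalerN -scaleNr addrC; apply: inU.
  apply/memW; rewrite (herm_compat herm) wt; split=> //.
  by apply: oppr_inj; rewrite -ip_J_r oppr0.
Qed.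

End HermitianLie.

(** * Orthogonal decompositions into J-invariant ideals *)

Section Decomposition.
Variables (R : realType) (G : vectType R).

(** Unlike in [irreducible_SKT], the summands may be zero, so that one of them can be shown to
    vanish. *)
Definition hermitian_decomposition (br : G -> G -> G) (J : G -> G)
    (ip : G -> G -> R) (U W : {vspace G}) : Prop :=
  [/\ (U + W)%VS = fullv /\ directv (U + W),
      (forall u w, u \in U -> w \in W -> ip u w = 0),
      lie_ideal br U /\ lie_ideal br W
    & J_invariant J U /\ J_invariant J W].

Lemma hermitian_decompositionC br J ip U W : is_inner_product ip ->
  hermitian_decomposition br J ip U W -> hermitian_decomposition br J ip W U.
Proof.
move=> ipI [[UWT UWd] UW [Ui Wi] [UJ WJ]]; split=> //.
- split; first by rewrite addvC.
  by apply/directv_addP; rewrite capvC; apply/directv_addP.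
- by move=> w u Ww Uu; rewrite (ip_sym ipI) UW.
Qed.

Variables (brG : G -> G -> G) (JG : G -> G) (ipG : G -> G -> R).
Hypotheses (brGL : is_lie_bracket brG) (ipGI : is_inner_product ipG).

Section Splitting.
Variables U W : {vspace G}.
Hypothesis dec : hermitian_decomposition brG JG ipG U W.

(** The vector [u, y] = -[w, y] lies in both ideals, which meet only in zero. *)
Lemma decomposition_br_eq0 u w y : u \in U -> w \in W ->
  brG (u + w) y = 0 -> brG u y = 0.
Proof.
case: dec => -[_ /directv_addP UWd] _ [Ui Wi] _ Uu Ww; rewrite (brDl brGL).
move/eqP; rewrite addr_eq0 => /eqP uw.
apply/eqP; rewrite -memv0 -UWd memv_cap.
apply/andP; split; first by rewrite (br_anti brGL) memvN Ui.
by rewrite uw (br_anti brGL) opprK Wi.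
Qed.

Lemma decomposition_memP x : exists u w, [/\ u \in U, w \in W & x = u + w].
Proof.
case: dec => -[UWT _] _ _ _; have : x \in (U + W)%VS by rewrite UWT memvf.
by move=> /memv_addP[u Uu [w Ww ->]]; exists u, w.
Qed.

End Splitting.

(* (V, br, J, ip) is a summand of G, with inclusion i and orthogonal
   projection pr. *)
Section Summand.
Variables (V : vectType R) (br : V -> V -> V) (J : V -> V) (ip : V -> V -> R).
Hypotheses (skt : is_SKT br J ip) (irr : irreducible_SKT br J ip).
Hypothesis nil : two_step_nilpotent br.
Variables (i : {linear V -> G}) (pr : G -> V).
Hypothesis prD : forall p q, pr (p + q) = pr p + pr q.
Hypothesis iK : cancel i pr.
Hypothesis br_i : forall p y, brG p (i y) = i (br (pr p) y).
Hypothesis ip_i : forall p y, ipG p (i y) = ip (pr p) y.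
Hypothesis J_i : forall y, JG (i y) = i (J y).

Let herm := skt.1.
Let brL := herm_lie herm.
Let ipI := herm_inner herm.

Let pr0 : pr 0 = 0. Proof. by rewrite -(linear0 i) iK. Qed.

(* The component pr u is central and orthogonal to [V, V] + J [V, V]. *)
Lemma pr_decomposition_eq0 U W u w : hermitian_decomposition brG JG ipG U W ->
  u \in U -> w \in W -> pr (u + w) = 0 -> pr u = 0.
Proof.
move=> dec Uu Ww uw0.
have uC y : br (pr u) y = 0.
  rewrite -[LHS]iK -br_i (decomposition_br_eq0 dec Uu Ww) //.
  by rewrite br_i uw0 (br0l brL) linear0.
case: (dec) => _ UW [Ui Wi] [UJ WJ].
(* As [pr (u + w) = 0], the image of [i] is orthogonal to [u + w]. If moreover [i z] is in [U], it
   is orthogonal to [w], hence to [u]. *)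
have perpU z : i z \in U -> ip (pr u) z = 0.
  move=> Uz; have := ip_i (u + w) z; rewrite uw0 (ip0l ipI) (ipDl ipGI) ip_i.
  by rewrite [ipG w _](ip_sym ipGI) UW // addr0.
have perpW z : i z \in W -> ip (pr u) z = 0.
  by move=> Wz; rewrite -ip_i UW.
have brU a y : a \in U -> i (br (pr a) y) \in U.
  by move=> Ua; rewrite -br_i (br_anti brGL) memvN Ui.
have brW a y : a \in W -> i (br (pr a) y) \in W.
  by move=> Wa; rewrite -br_i (br_anti brGL) memvN Wi.
apply: (irreducible_no_flat_factor herm irr nil) => [|y|x y|x y] //.
- exact: (center_J_invariant herm uC skt.2 nil).
(* Projecting the splitting of [i x] writes [x, y] as a sum of two brackets whose images under [i]
   lie in [U] and in [W]; [pr u] is orthogonal to both. *)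
- have [a [b [Ua Wb xE]]] := decomposition_memP dec (i x).
  rewrite -[x]iK xE prD (brDl brL) (ipDr ipI).
  by rewrite perpU ?perpW ?addr0 ?brU ?brW.
(* The same splitting, after moving [J] onto the bracket by skew-adjointness; [U] and [W] are
   J-invariant. *)
- have [a [b [Ua Wb xE]]] := decomposition_memP dec (i x).
  apply: oppr_inj; rewrite -(ip_J_r herm) -[x]iK xE prD (brDl brL).
  rewrite (JD herm) (ipDr ipI) perpU ?perpW ?addr0 ?oppr0 -?J_i //.
    exact/WJ/brW.
  exact/UJ/brU.
Qed.

(** By the splitting hypothesis, the preimages of [U] and [W] under [i] span [V]. They are
    orthogonal J-invariant ideals, so irreducibility makes one of them zero. *)
Lemma summand_dichotomy U W : hermitian_decomposition brG JG ipG U W ->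
  (forall x u w, u \in U -> w \in W -> i x = u + w ->
     u = i (pr u) /\ w = i (pr w)) ->
  (forall x, i x \in U) \/ (forall x, i x \in W).
Proof.
move=> dec split_i.
case: (dec) => -[_ UWd] UW [Ui Wi] [UJ WJ].
pose U1 := (linfun i @^-1: U)%VS; pose W1 := (linfun i @^-1: W)%VS.
have memU1 x : (x \in U1) = (i x \in U) by rewrite -memv_preim lfunE.
have memW1 x : (x \in W1) = (i x \in W) by rewrite -memv_preim lfunE.
have split1 x : exists u w, [/\ u \in U1, w \in W1 & x = u + w].
  have [u [w [Uu Ww xE]]] := decomposition_memP dec (i x).
  have [uE wE] := split_i x u w Uu Ww xE.
  exists (pr u), (pr w); rewrite memU1 memW1 -uE -wE; split=> //.
  by rewrite -prD -xE iK.
have perp1 u w : u \in U1 -> w \in W1 -> ip u w = 0.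
  by rewrite memU1 memW1 -{2}[u]iK -ip_i; apply: UW.
have ideal1 (S : {vspace G}) x u : lie_ideal brG S ->
    i u \in S -> i (br x u) \in S.
  by move=> Si Su; rewrite -[x]iK -br_i; apply: Si.
have [W1T|/eqP W10] := eqVneq W1 0%VS.
  left=> x; rewrite -memU1; have [u [w [Uu Ww ->]]] := split1 x.
  by move: Ww; rewrite W1T memv0 => /eqP->; rewrite addr0.
have [U1T|/eqP U10] := eqVneq U1 0%VS.
  right=> x; rewrite -memW1; have [u [w [Uu Ww ->]]] := split1 x.
  by move: Uu; rewrite U1T memv0 => /eqP->; rewrite add0r.
case: irr; exists U1, W1; split=> //.
- split; last exact: (orthogonal_directv herm).
  apply/eqP; rewrite eqEsubv subvf /=; apply/subvP=> x _.
  by have [u [w [Uu Ww ->]]] := split1 x; apply: memv_add.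
- by split=> x u; rewrite ?memU1 ?memW1; apply: ideal1.
- by split=> u; rewrite ?memU1 ?memW1 -J_i => ?; [apply: UJ | apply: WJ].
Qed.

End Summand.
End Decomposition.

(** * The glued algebra is SKT *)

Section GlueTheory.
Variables (R : realType) (V1 V2 : vectType R).
Variables (br1 : V1 -> V1 -> V1) (J1 : V1 -> V1) (ip1 : V1 -> V1 -> R).
Variables (br2 : V2 -> V2 -> V2) (J2 : V2 -> V2) (ip2 : V2 -> V2 -> R).
Hypotheses (skt1 : is_SKT br1 J1 ip1) (nil1 : two_step_nilpotent br1).
Hypotheses (skt2 : is_SKT br2 J2 ip2) (nil2 : two_step_nilpotent br2).
Variables (X : V1) (Y : V2).
Hypotheses (XC : forall y, br1 X y = 0) (YC : forall y, br2 Y y = 0).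
Hypothesis XD : forall x y, ip1 X (br1 x y) = 0.
Hypothesis YD : forall x y, ip2 Y (br2 x y) = 0.
Hypotheses (XX : ip1 X X = 1) (YY : ip2 Y Y = 1).

Local Notation G := (glue V1 V2).
Let br := glue_br br1 br2 X Y.
Let J : G -> G := glue_J J1 J2.
Let ip : G -> G -> R := glue_ip ip1 ip2.

Let herm1 := skt1.1.
Let herm2 := skt2.1.
Let br1L := herm_lie herm1.
Let br2L := herm_lie herm2.
Let ip1I := herm_inner herm1.
Let ip2I := herm_inner herm2.

Lemma glue_is_lie_bracket : is_lie_bracket br.
Proof.
have combo (V : lmodType R) (P Q X0 : V) (k s t r : R) : r = k * s + t ->
    k *: P + Q + r *: X0 = k *: (P + s *: X0) + (Q + t *: X0).
  by move=> ->; rewrite scalerDl scalerDr scalerA addrACA.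
split.
- move=> [[y1 y2] [c d]] k [[u1 u2] [a b]] [[v1 v2] [a' b']].
  congr (_, _, (_, _)) => /=; last 2 first.
  - by rewrite scaler0 addr0.
  - by rewrite scaler0 addr0.
  - rewrite (brDl br1L) (brZl br1L); apply: combo.
    by rewrite /GRing.scale /=; ring.
  - rewrite (brDl br2L) (brZl br2L); apply: combo.
    by rewrite /GRing.scale /=; ring.
- move=> [[y1 y2] [c d]] k [[u1 u2] [a b]] [[v1 v2] [a' b']].
  congr (_, _, (_, _)) => /=; last 2 first.
  - by rewrite scaler0 addr0.
  - by rewrite scaler0 addr0.
  - rewrite (brDr br1L) (brZr br1L); apply: combo.
    by rewrite /GRing.scale /=; ring.
  - rewrite (brDr br2L) (brZr br2L); apply: combo.
    by rewrite /GRing.scale /=; ring.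
- move=> [[x1 x2] [a b]].
  rewrite /br /= (lie_alternating br1L) (lie_alternating br2L).
  by rewrite [b * a]mulrC subrr !scale0r !addr0.
- move=> [[x1 x2] [a b]] [[y1 y2] [c d]] [[z1 z2] [e f]].
  (* Inner brackets have no plane part, and their [X] and [Y] terms are central, so only the Jacobi
     identities of the summands remain. *)
  have XCr y : br1 y X = 0 by rewrite (br_anti br1L) XC oppr0.
  have YCr y : br2 y Y = 0 by rewrite (br_anti br2L) YC oppr0.
  congr (_, _, (_, _)) => /=; rewrite ?addr0 //.
  - rewrite !mulr0 !subr0 !scale0r !addr0 !(brDr br1L) !(brZr br1L) !XCr.
    by rewrite !scaler0 !addr0 (lie_jacobi br1L).
  - rewrite !mulr0 !subr0 !scale0r !addr0 !(brDr br2L) !(brZr br2L) !YCr.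
    by rewrite !scaler0 !addr0 (lie_jacobi br2L).
Qed.

Lemma glue_is_complex_structure : is_complex_structure br J.
Proof.
split.
- move=> k [[x1 x2] [a b]] [[y1 y2] [c d]].
  congr (_, _, (_, _)) => /=; rewrite ?(JD herm1) ?(JZ herm1) //.
  - by rewrite (JD herm2) (JZ herm2).
  - by rewrite opprD scalerN.
- by move=> [[x1 x2] [a b]]; rewrite /J /= (JJ herm1) (JJ herm2).
- move=> [[x1 x2] [a b]] [[y1 y2] [c d]].
  (* On the plane, omega(Jp, Jq) = omega(p, q) and omega(Jp, q) = -omega(p, Jq). Hence the [X]
     coefficients agree and the [J X] terms cancel, and likewise for [Y]. *)
  have combo (V : lmodType R) (P Q S X0 JX0 : V) (s t u v : R) :
      s = t -> u = - v ->
      P + Q + S + s *: X0 = P + t *: X0 + (Q + u *: JX0) + (S + v *: JX0).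
    move=> -> ->; rewrite scaleNr -[RHS]addrA [X in _ = _ + X]addrACA.
    rewrite addNr addr0.
    by rewrite -!addrA; congr (_ + _); rewrite [RHS]addrC addrA.
  congr (_, _, (_, _)) => /=; rewrite ?oppr0 ?addr0 //.
  - rewrite (cs_integrable (herm_complex herm1)) !(JD herm1) !(JZ herm1).
    by apply: combo; ring.
  - rewrite (cs_integrable (herm_complex herm2)) !(JD herm2) !(JZ herm2).
    by apply: combo; ring.
Qed.

Lemma glue_is_inner_product : is_inner_product ip.
Proof.
split.
- move=> [[y1 y2] [c d]] k [[u1 u2] [a b]] [[v1 v2] [a' b']] /=.
  rewrite /ip /= !(ipDl ip1I) !(ipZl ip1I) !(ipDl ip2I) !(ipZl ip2I).
  by rewrite /GRing.scale /=; ring.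
- move=> [[x1 x2] [a b]] [[y1 y2] [c d]].
  by rewrite /ip /= (ip_sym ip1I) (ip_sym ip2I) [c * a]mulrC [d * b]mulrC.
- have nneg (V : vectType R) (f : V -> V -> R) x :
      is_inner_product f -> 0 <= f x x.
    move=> fI; have [->|/(ip_pos fI)/ltW //] := eqVneq x 0.
    by rewrite (ip0l fI).
  move=> [[x1 x2] [a b]] p0; rewrite /ip /= lt0r.
  have p1 := nneg _ _ x1 ip1I; have p2 := nneg _ _ x2 ip2I.
  have pa := sqr_ge0 a; have pb := sqr_ge0 b.
  rewrite -!expr2 !addr_ge0 // andbT; apply: contra p0.
  rewrite !paddr_eq0 ?addr_ge0 // !sqrf_eq0.
  move=> /andP[/andP[/eqP/(ip_eq0 ip1I)-> /eqP/(ip_eq0 ip2I)->]].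
  by move=> /andP[/eqP-> /eqP->].
Qed.

Lemma glue_is_hermitian : is_hermitian_lie br J ip.
Proof.
split.
- exact: glue_is_lie_bracket.
- exact: glue_is_complex_structure.
- exact: glue_is_inner_product.
- move=> [[x1 x2] [a b]] [[y1 y2] [c d]].
  by rewrite /ip /= (herm_compat herm1) (herm_compat herm2); ring.
Qed.

(** The coefficients are the values of omega on pairs of plane components; [J] drops out of them
    because it preserves omega. *)
Lemma glue_bismut (x1 y1 z1 : V1) (x2 y2 z2 : V2) (a b c d e f : R) :
  bismut_torsion br J ip (x1, x2, (a, b)) (y1, y2, (c, d)) (z1, z2, (e, f)) =
  bismut_torsion br1 J1 ip1 x1 y1 z1 + bismut_torsion br2 J2 ip2 x2 y2 z2
  - (a * d - b * c) * (ip1 X z1 + ip2 Y z2)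
  - (c * f - d * e) * (ip1 X x1 + ip2 Y x2)
  - (e * b - f * a) * (ip1 X y1 + ip2 Y y2).
Proof.
rewrite /bismut_torsion /ip /= !(ipDl ip1I) !(ipZl ip1I).
rewrite !(ipDl ip2I) !(ipZl ip2I).
ring.
Qed.

Lemma glue_closed_torsion w u y z : d_bismut_torsion br J ip w u y z = 0.
Proof.
case: w u y z => -[w1 w2] [w3 w4] [[u1 u2] [u3 u4]].
move=> [[y1 y2] [y3 y4]] [[z1 z2] [z3 z4]].
(* A bracket in the glued algebra has an extra multiple of [X] in its [V1] component, and
   contraction with [X] kills the torsion of [V1]. *)
have bD1 x k p q : bismut_torsion br1 J1 ip1 (x + k *: X) p q =
    bismut_torsion br1 J1 ip1 x p q.
  rewrite (bismutDl herm1) (bismutZl herm1).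
  have JXC := center_J_invariant herm1 XC skt1.2 nil1.
  by rewrite [X in _ * X](bismut_center_eq0 herm1) ?mulr0 ?addr0.
have bD2 x k p q : bismut_torsion br2 J2 ip2 (x + k *: Y) p q =
    bismut_torsion br2 J2 ip2 x p q.
  rewrite (bismutDl herm2) (bismutZl herm2).
  have JYC := center_J_invariant herm2 YC skt2.2 nil2.
  by rewrite [X in _ * X](bismut_center_eq0 herm2) ?mulr0 ?addr0.
have := skt1.2 w1 u1 y1 z1; have := skt2.2 w2 u2 y2 z2.
rewrite /d_bismut_torsion /= !glue_bismut !bD1 !bD2.
rewrite !(ipDr ip1I) !(ipZr ip1I) !(ipDr ip2I) !(ipZr ip2I) !XD !YD XX YY.
set A2 := (X in X = 0 -> _); set A1 := (X in _ -> X = 0 -> _) => E2 E1.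
(* Beyond [A1 + A2] there remains a multiple of omega(w,u) omega(y,z) - omega(w,y) omega(u,z) +
   omega(w,z) omega(u,y), which vanishes identically on a plane. *)
transitivity (A1 + A2); last by rewrite E1 E2 addr0.
rewrite /A1 /A2; ring.
Qed.

(** * Irreducibility of the glued algebra *)

Hypotheses (irr1 : irreducible_SKT br1 J1 ip1).
Hypotheses (irr2 : irreducible_SKT br2 J2 ip2).

Definition glue_inl (x : V1) : G := (x, 0, (0, 0)).
Definition glue_inr (x : V2) : G := (0, x, (0, 0)).

Lemma glue_inl_linear : linear glue_inl.
Proof. by move=> k x y; congr (_, _, (_, _)); rewrite /= scaler0 addr0. Qed.

Lemma glue_inr_linear : linear glue_inr.
Proof. by move=> k x y; congr (_, _, (_, _)); rewrite /= scaler0 addr0. Qed.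

HB.instance Definition _ :=
  GRing.isLinear.Build R V1 G *:%R glue_inl glue_inl_linear.
HB.instance Definition _ :=
  GRing.isLinear.Build R V2 G *:%R glue_inr glue_inr_linear.

Lemma glue_br_inl p y : br p (glue_inl y) = glue_inl (br1 p.1.1 y).
Proof.
case: p => -[x1 x2] [a b]; rewrite /br /glue_inl /=.
by rewrite !mulr0 subr0 !scale0r !addr0 (br0r br2L).
Qed.

Lemma glue_br_inr p y : br p (glue_inr y) = glue_inr (br2 p.1.2 y).
Proof.
case: p => -[x1 x2] [a b]; rewrite /br /glue_inr /=.
by rewrite !mulr0 subr0 !scale0r !addr0 (br0r br1L).
Qed.

Lemma glue_ip_inl p y : ip p (glue_inl y) = ip1 p.1.1 y.
Proof.
by case: p => -[x1 x2] [a b]; rewrite /ip /= (ip0r ip2I) !mulr0 !addr0.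
Qed.

Lemma glue_ip_inr p y : ip p (glue_inr y) = ip2 p.1.2 y.
Proof.
by case: p => -[x1 x2] [a b]; rewrite /ip /= (ip0r ip1I) !mulr0 !addr0 add0r.
Qed.

Lemma glue_J_inl y : J (glue_inl y) = glue_inl (J1 y).
Proof. by rewrite /J /glue_inl /= (J0 herm2) oppr0. Qed.

Lemma glue_J_inr y : J (glue_inr y) = glue_inr (J2 y).
Proof. by rewrite /J /glue_inr /= (J0 herm1) oppr0. Qed.

Lemma X_neq0 : X != 0.
Proof.
by apply: contra_eqN XX => /eqP->; rewrite (ip0l ip1I) eq_sym oner_eq0.
Qed.

Let Z : G := (0, 0, (1, 0)).
Let W : G := (0, 0, (0, 1)).

Lemma glue_br_Z p : br p Z = (- p.2.2 *: X, - p.2.2 *: Y, (0, 0)).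
Proof.
case: p => -[x1 x2] [a b].
by rewrite /br /= (br0r br1L) (br0r br2L) !add0r mulr0 mulr1 sub0r.
Qed.

Lemma glue_br_W p : br p W = (p.2.1 *: X, p.2.1 *: Y, (0, 0)).
Proof.
case: p => -[x1 x2] [a b].
by rewrite /br /= (br0r br1L) (br0r br2L) !add0r mulr0 mulr1 subr0.
Qed.

(** These brackets carry the plane coordinates of [p], up to sign, as coefficients of the nonzero
    vector [X]. *)
Lemma glue_br_ZW_eq0 p : br p Z = 0 -> br p W = 0 -> p.2 = (0, 0).
Proof.
rewrite glue_br_Z glue_br_W => -[] /eqP + _ [] /eqP + _.
rewrite !scaler_eq0 (negPf X_neq0) !orbF oppr_eq0.
by case: p.2 => a b /= /eqP-> /eqP->.
Qed.

Local Notation decomposition := (hermitian_decomposition br J ip).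

Section Splitting.
Variables U T : {vspace G}.
Hypothesis dec : decomposition U T.

Lemma glue_dichotomy_l :
  (forall x, glue_inl x \in U) \/ (forall x, glue_inl x \in T).
Proof.
(* Stated for an arbitrary decomposition, so that exchanging the two ideals also handles the other
   component. *)
have half U' T' x u w : decomposition U' T' -> u \in U' -> w \in T' ->
    glue_inl x = u + w -> u = glue_inl u.1.1.
  move=> dec' Uu Tw xE.
  have E2 : u.1.2 = 0.
    apply: (pr_decomposition_eq0 glue_is_lie_bracket glue_is_inner_product
      skt2 irr2 nil2 (i := glue_inr) _ _ glue_br_inr glue_ip_inr glue_J_inr
      dec' Uu Tw) => //.
    by rewrite -xE.
  (* Since [glue_inl x] commutes with [Z] and [W], so does its component [u], which therefore has no
     plane part. *)
  have := glue_br_ZW_eq0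
    (decomposition_br_eq0 glue_is_lie_bracket dec' Uu Tw _)
    (decomposition_br_eq0 glue_is_lie_bracket dec' Uu Tw _).
  rewrite -xE glue_br_Z glue_br_W /= oppr0 !scale0r => /(_ erefl erefl).
  by move: E2; case: (u) => -[u1 u2] u3 /= -> ->.
apply: (summand_dichotomy skt1 irr1 (i := glue_inl) (pr := fun p => p.1.1)
  _ _ glue_br_inl glue_ip_inl glue_J_inl dec) => // x u w Uu Tw xE.
have decC := hermitian_decompositionC glue_is_inner_product dec.
by split; [apply: (half U T x u w) | apply: (half T U x w u); rewrite // addrC].
Qed.

(** The argument of [glue_dichotomy_l] with [V1] and [V2] exchanged. *)
Lemma glue_dichotomy_r :
  (forall x, glue_inr x \in U) \/ (forall x, glue_inr x \in T).
Proof.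
have half U' T' x u w : decomposition U' T' -> u \in U' -> w \in T' ->
    glue_inr x = u + w -> u = glue_inr u.1.2.
  move=> dec' Uu Tw xE.
  have E1 : u.1.1 = 0.
    apply: (pr_decomposition_eq0 glue_is_lie_bracket glue_is_inner_product
      skt1 irr1 nil1 (i := glue_inl) (pr := fun p => p.1.1) _ _
      glue_br_inl glue_ip_inl glue_J_inl dec' Uu Tw) => //.
    by rewrite -xE.
  have := glue_br_ZW_eq0
    (decomposition_br_eq0 glue_is_lie_bracket dec' Uu Tw _)
    (decomposition_br_eq0 glue_is_lie_bracket dec' Uu Tw _).
  rewrite -xE glue_br_Z glue_br_W /= oppr0 !scale0r => /(_ erefl erefl).
  by move: E1; case: (u) => -[u1 u2] u3 /= -> ->.
apply: (summand_dichotomy skt2 irr2 (i := glue_inr) (pr := fun p => p.1.2)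
  _ _ glue_br_inr glue_ip_inr glue_J_inr dec) => // x u w Uu Tw xE.
have decC := hermitian_decompositionC glue_is_inner_product dec.
by split; [apply: (half U T x u w) | apply: (half T U x w u); rewrite // addrC].
Qed.

(** Orthogonality to [U] puts [T] inside the plane. Brackets of its elements with [Z] and [W] are
    multiples of X + Y that stay in [T], so they vanish, and with them the plane coordinates. *)
Lemma glue_both_summands_eq0 : (forall x, glue_inl x \in U) ->
  (forall x, glue_inr x \in U) -> T = 0%VS.
Proof.
case: dec => _ UT [_ Ti] _ U1 U2.
apply/eqP; rewrite -subv0; apply/subvP=> -[[t1 t2] [a b]] tT; rewrite memv0.
have T1 (t : G) : t \in T -> t.1.1 = 0.
  move=> tT'; apply: (ip_eq0 ip1I).
  by rewrite -glue_ip_inl (ip_sym glue_is_inner_product) UT.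
have T2 (t : G) : t \in T -> t.1.2 = 0.
  move=> tT'; apply: (ip_eq0 ip2I).
  by rewrite -glue_ip_inr (ip_sym glue_is_inner_product) UT.
have brT v : br (t1, t2, (a, b)) v \in T.
  by rewrite (br_anti glue_is_lie_bracket) memvN Ti.
have := T1 _ (brT Z); have := T1 _ (brT W); rewrite glue_br_W glue_br_Z /=.
move=> /eqP + /eqP; rewrite !scaler_eq0 (negPf X_neq0) !orbF oppr_eq0.
by move: (T1 _ tT) (T2 _ tT) => /= -> -> /eqP-> /eqP->.
Qed.

(* Z = u + w gives [u, W] = a (X + Y) and [w, W] = b (X + Y) with a + b = 1;
   the former is orthogonal to Y and the latter to X, so a = b = 0. *)
Lemma glue_summands_not_separated : (forall x, glue_inl x \in U) ->
  ~ (forall x, glue_inr x \in T).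
Proof.
case: (dec) => _ UT [Ui Ti] _ U1 T2.
have [u [w [Uu Tw ZE]]] := decomposition_memP dec Z.
have : br u W \in U by rewrite (br_anti glue_is_lie_bracket) memvN Ui.
move=> /UT/(_ (T2 Y)); rewrite glue_ip_inr glue_br_W /=.
rewrite (ipZl ip2I) YY mulr1 => a0.
have : br w W \in T by rewrite (br_anti glue_is_lie_bracket) memvN Ti.
move=> /(UT _ _ (U1 X)); rewrite (ip_sym glue_is_inner_product) glue_ip_inl.
rewrite glue_br_W /= (ipZl ip1I) XX mulr1 => b0.
have : Z.2.1 = u.2.1 + w.2.1 by rewrite ZE.
by rewrite a0 b0 addr0 /= => /eqP; rewrite oner_eq0.
Qed.

End Splitting.

Lemma glue_irreducible : irreducible_SKT br J ip.
Proof.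
move=> [U [T [[U0 T0] dUT UT UTi UTJ]]].
have dec : decomposition U T by split.
have decC := hermitian_decompositionC glue_is_inner_product dec.
case: (glue_dichotomy_l dec) (glue_dichotomy_r dec) => [lU|lT] [rU|rT].
- exact: T0 (glue_both_summands_eq0 dec lU rU).
- exact: glue_summands_not_separated dec lU rT.
- exact: glue_summands_not_separated decC lT rU.
- exact: U0 (glue_both_summands_eq0 decC lT rT).
Qed.

End GlueTheory.

Theorem mainTheorem3 (R : realType) (V1 V2 : vectType R)
  (br1 : V1 -> V1 -> V1) (J1 : V1 -> V1) (ip1 : V1 -> V1 -> R)
  (br2 : V2 -> V2 -> V2) (J2 : V2 -> V2) (ip2 : V2 -> V2 -> R)
  (skt1 : is_SKT br1 J1 ip1) (irr1 : irreducible_SKT br1 J1 ip1)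
  (nil1 : two_step_nilpotent br1)
  (dim1 : (\dim (derived_algebra br1) < \dim (lie_center br1))%N)
  (skt2 : is_SKT br2 J2 ip2) (irr2 : irreducible_SKT br2 J2 ip2)
  (nil2 : two_step_nilpotent br2)
  (dim2 : (\dim (derived_algebra br2) < \dim (lie_center br2))%N)
  (X : V1) (X_center : X \in lie_center br1)
  (X_orth : in_orthogonal ip1 (derived_algebra br1) X) (X_unit : ip1 X X = 1)
  (Y : V2) (Y_center : Y \in lie_center br2)
  (Y_orth : in_orthogonal ip2 (derived_algebra br2) Y) (Y_unit : ip2 Y Y = 1) :
  let br := @glue_br R V1 V2 br1 br2 X Y in
  let J := @glue_J R V1 V2 J1 J2 in
  let ip := @glue_ip R V1 V2 ip1 ip2 in
  is_SKT br J ip /\ irreducible_SKT br J ip.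
Proof.
have XC := proj1 (mem_lie_center X (herm_lie skt1.1)) X_center.
have YC := proj1 (mem_lie_center Y (herm_lie skt2.1)) Y_center.
have XD x y := X_orth _ (mem_derived (herm_lie skt1.1) x y).
have YD x y := Y_orth _ (mem_derived (herm_lie skt2.1) x y).
split; last exact: glue_irreducible.
split; first exact: glue_is_hermitian.
exact: glue_closed_torsion.
Qed.
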